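(* Let $\mathfrak g$ be a complex simple Lie algebra and let $z\in\mathfrak t_{\mathbb Q}$ be an arbitrary element such that $\gamma(z)\in\{-1,0,1,2\}$ for all $\gamma\in\Delta^+$. (i) If $\gamma\in\Delta^+_z(0)$ is not a sum of two roots from $\Delta^+_z(0)$, then $w_z(\gamma)\in\Pi$. (ii) If $\theta(z)=1$, i.e., $\theta\in\Delta^+_z(1)$, then $w_z(\theta)\in-\Pi$.
   Context: Let $\mathfrak t$ be a Cartan subalgebra of $\mathfrak g$, $\Delta$ the root system, $\Delta^+$ a fixed set of positive roots, $\Delta^-=-\Delta^+$, $\Pi$ the simple roots, $\theta$ the highest root, $W$ the Weyl group, $\mathfrak t_{\mathbb Q}\subset\mathfrak t$ the rational form on which all roots take rational values. For $z$ as in the claim put $\Delta^+_z(i)=\{\gamma\in\Delta^+\mid\gamma(z)=i\}$, so that $\Delta^+=\bigsqcup_{i=-1}^2\Delta^+_z(i)$. The sets $\Delta^+_z(1)\sqcup\Delta^+_z(2)$ and $\Delta^+_z(-1)\sqcup\Delta^+_z(0)$ are closed under root addition, so there is a unique $w_z\in W$ with inversion set $\{\gamma\in\Delta^+\mid w_z(\gamma)\in\Delta^-\}=\Delta^+_z(1)\sqcup\Delta^+_z(2)$. *)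

(* Defs.v *)
From HB Require Import structures.
From mathcomp Require Import all_boot all_order all_algebra.
From mathcomp Require Import classical_sets.

Set Implicit Arguments.
Unset Strict Implicit.
Unset Printing Implicit Defensive.
Import Order.TTheory GRing.Theory Num.Theory.
Local Open Scope classical_set_scope.
Local Open Scope ring_scope.

HB.mixin Record Vector_isLieAlgebra (K : fieldType) V of Vector K V := {
  lie : V -> V -> V;
  lie_linearl : forall y : V, linear (fun x : V => lie x y);
  lie_linearr : forall x : V, linear (lie x);
  liexx : forall x : V, lie x x = 0;
  lie_jacobi : forall x y z : V,
    lie x (lie y z) + lie y (lie z x) + lie z (lie x y) = 0
}.

(* Being built over [Vector], these Lie algebras are finite-dimensional. *)
#[short(type="lieAlgebraType")]
HB.structure Definition LieAlgebra (K : fieldType) :=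
  { V of Vector K V & Vector_isLieAlgebra K V }.

Section LieAlgebras.
Variables (K : fieldType) (g : lieAlgebraType K).

HB.instance Definition _ (x : g) :=
  GRing.isLinear.Build K g g *:%R (lie x) (lie_linearr x).

Definition ad (x : g) : 'End(g) := linfun (lie x).

Lemma adE (x y : g) : ad x y = lie x y.
Proof. exact: lfunE. Qed.

Lemma lie_suml (I : finType) (F : I -> g) (y : g) :
  lie (\sum_i F i) y = \sum_i lie (F i) y.
Proof.
have lD : {morph (fun x : g => lie x y) : u v / u + v}.
  by move=> u v /=; have := lie_linearl y 1 u v; rewrite !scale1r.
have l0 : lie 0 y = 0 :> g.
  have := lD 0 0; rewrite /= addr0 => /esym/eqP.
  by rewrite addrC -subr_eq0 addrK => /eqP.
exact: (big_morph (fun x : g => lie x y) lD l0).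
Qed.

Lemma lieZl (k : K) (x y : g) : lie (k *: x) y = k *: lie x y.
Proof.
have := lie_linearl y k x 0.
have := lie_linearl y (-1) 0 0; rewrite scaler0 addr0 scaleN1r addNr => ->.
by rewrite !addr0.
Qed.

Implicit Types A B I t : {vspace g}.

(* [A, B], the linear span of the brackets of elements of A and of B (by
   bilinearity bases suffice, see lie_prodP). *)
Definition lie_prod A B : {vspace g} :=
  <<[seq lie x y | x <- vbasis A, y <- vbasis B]>>%VS.

Definition is_ideal I : Prop := (lie_prod fullv I <= I)%VS.

Definition simple_lie : Prop :=
  lie_prod fullv fullv <> 0%VS /\
  forall I, is_ideal I -> I = 0%VS \/ I = fullv.

Definition is_subalgebra A : Prop := (lie_prod A A <= A)%VS.

(* The lower central series of the subalgebra A reaches 0. *)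
Definition is_nilpotent A : Prop :=
  exists n : nat, iter n (lie_prod A) A = 0%VS.

Definition normalizes A (x : g) : Prop := forall y, y \in A -> lie x y \in A.

Definition is_cartan t : Prop :=
  [/\ is_subalgebra t, is_nilpotent t & forall x, normalizes t x -> x \in t].

Lemma lie_prodP A B C :
  (lie_prod A B <= C)%VS <-> (forall x y, x \in A -> y \in B -> lie x y \in C).
Proof.
split=> [/span_subvP sABC x y xA yB | h]; last first.
  apply/span_subvP=> _ /allpairsP[[x y] /= [xA yB ->]].
  by apply: h; apply: vbasis_mem.
pose f := linfun (HB.pack_for {linear g -> g} (lie^~ y)
  (GRing.isLinear.Build K g g *:%R (lie^~ y) (lie_linearl y))).
have fE u : f u = lie u y by rewrite lfunE.
have fA u : u \in vbasis A -> f u \in C.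
  move=> uA; rewrite fE.
  rewrite -adE; have : (<<vbasis B>> <= ad u @^-1: C)%VS.
    apply/span_subvP=> v vB; rewrite -memv_preim adE; apply: sABC.
    by apply/allpairsP; exists (u, v).
  by rewrite (span_basis (vbasisP B)) => /subvP/(_ y yB); rewrite -memv_preim.
have : (<<vbasis A>> <= f @^-1: C)%VS.
  by apply/span_subvP=> u uA; rewrite -memv_preim fA.
rewrite (span_basis (vbasisP A)) => /subvP/(_ x xA).
by rewrite -memv_preim fE.
Qed.

End LieAlgebras.

(* t^*, the space of linear forms on the subspace t of g. *)
Definition dual (K : fieldType) (g : lieAlgebraType K) (t : {vspace g}) :=
  'Hom(subvs_of t, K^o).

Section Roots.
Variables (K : numFieldType) (g : lieAlgebraType K) (t : {vspace g}).
Implicit Types (a b c : dual t) (h z : subvs_of t) (w s : 'End(dual t)).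
Implicit Types P : set (dual t).

(* The joint eigenspace of t for the weight a, see root_spaceP. *)
Definition root_space a : {vspace g} :=
  (\bigcap_(h <- vbasis {:subvs_of t})
     lker (ad (val h) - (a h : K) *: \1%VF))%VS.

Lemma root_spaceP a (x : g) :
  x \in root_space a <-> (forall h, lie (val h) x = (a h : K) *: x).
Proof.
pose E h := lker (ad (val h) - (a h : K) *: \1%VF).
have inE h : (x \in E h) = (lie (val h) x == (a h : K) *: x).
  by rewrite memv_ker add_lfunE opp_lfunE scale_lfunE id_lfunE adE subr_eq0.
have capP (r : seq (subvs_of t)) :
    (x \in (\bigcap_(h <- r) E h)%VS) = all (fun h => x \in E h) r.
  by elim: r => [|h r IH]; rewrite ?big_nil ?memvf // big_cons memv_cap IH.
rewrite /root_space capP; split=> [/allP xE h | xE]; last first.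
  by apply/allP=> h _; rewrite inE; apply/eqP.
rewrite (coord_vbasis (memvf h)) !linear_sum /= scaler_suml.
rewrite lie_suml; apply: eq_bigr => i _.
set k := coord _ _ _; set b := (vbasis _)`_i.
have bE : lie (val b) x = (a b : K) *: x.
  by apply/eqP; rewrite -inE; apply: xE; apply: mem_nth; rewrite size_tuple.
by rewrite !linearZ /= lieZl bE scalerA.
Qed.

Definition roots : set (dual t) :=
  [set a | a <> 0 /\ root_space a <> 0%VS].

(* t_Q, on which all the roots take rational values *)
Definition rational_form : set (subvs_of t) :=
  [set h | forall a, roots a -> exists q : rat, a h = ratr q].

(* A choice of positive roots: the roots are partitioned into P and - P, where
   P = {a root | a h > 0} for a regular element h of t_Q. *)
Definition positive_system P : Prop :=
  roots = P `|` [set - a | a in P] /\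
  exists2 h, rational_form h & forall a, P a -> 0 < a h.

Definition simple_roots P : set (dual t) :=
  [set a | P a /\ ~ exists b c, [/\ P b, P c & a = b + c]].

(* For every root c, the difference a - c is a sum of simple roots (with
   repetitions), that is, a combination with coefficients in nat. *)
Definition highest_root P a : Prop :=
  roots a /\
  forall c, roots c -> exists r : seq (dual t),
    (forall b, b \in r -> simple_roots P b) /\ a - c = \sum_(b <- r) b.

Definition is_coroot a h : Prop :=
  val h \in lie_prod (root_space a) (root_space (- a)) /\ a h = 2.

Definition is_reflection a s : Prop :=
  exists2 h, is_coroot a h & forall c, s c = c - (c h : K) *: a.

(* The reflections being involutions, the monoid that they generate is a
   group. *)
Inductive weyl : set 'End(dual t) :=
| weyl1 : weyl \1%VF
| weylM a s w : roots a -> is_reflection a s -> weyl w -> weyl (s \o w)%VF.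

Definition inversions P w : set (dual t) :=
  [set a | P a /\ [set - b | b in P] (w a)].

(* Delta^+_z(i), where Delta^+ = P *)
Definition level P z (i : int) : set (dual t) :=
  [set a | P a /\ a z = i%:~R].

(* w is the element w_z of the Weyl group, characterized by its inversions. *)
Definition is_wz P z w : Prop :=
  weyl w /\ inversions P w = level P z 1 `|` level P z 2.

End Roots.

(* Main.v *)
From HB Require Import structures.
Require Import Defs.
From mathcomp Require Import all_boot all_order all_algebra.
From mathcomp Require Import boolp classical_sets reals.
From mathcomp Require Import complex.
From mathcomp Require Import ring.
Set Implicit Arguments.
Unset Strict Implicit.
Unset Printing Implicit Defensive.
Import Order.TTheory GRing.Theory Num.Theory. Import passmx.
Local Open Scope classical_set_scope.
Local Open Scope ring_scope.
Local Open Scope complex_scope.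

(** The proof has two layers.

    The combinatorial layer evaluates roots at [z]. Since the inversions of
    [w] are the positive roots of level 1 and 2, a root [b] with [w b] positive
    is either positive of level 0 or -1, or the opposite of a positive root of
    level 1 or 2; so its level is never positive, and a root of level 0 among
    them is itself positive ([wz_preimage_level]). For (i), a decomposition of
    [w a] into two positive roots pulls back along [w] to a decomposition of
    [a] into two roots whose levels are at most 0 and add up to 0; both levels
    are 0 and both roots are positive, against the hypothesis on [a]. For (ii),
    a decomposition of [- w theta] pulls back to [- theta = b + c] with levels
    adding up to -1, so that one of them, say that of [b], is 0; then [b] is
    positive and [theta + b = - c] is a root above the highest root.

    This needs [w] to be a bijection of the set of roots, which is the Lie
    theoretic layer: a reflection [c |-> c - c(h) a] given by a coroot [h] maps
    roots to roots ([reflection_roots]). As the zero weight space of a Cartan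
    subalgebra [t] lies in [t], brackets of vectors of weights [a] and [- a]
    belong to [t], and one of them gives, after scaling, an sl2-triple
    [x, y, h'] with [a(h') = 2] ([coroot_sl2]). The representation theory of
    sl2 then provides a vector of weight [c - c(h') a]
    ([sl2_weight_reflection]). Finally [h - h'] is a sum of such brackets on
    which [a] vanishes; a trace argument ([lie_prod_eigenvalue0]) shows that
    all the weights vanish on it too, so that [c(h) = c(h')]. *)

(* The name also denotes the representatives of the components of a graph. *)
Local Notation roots := Defs.roots.

(** * Brackets *)

Section LieCalculus.
Variables (K : fieldType) (g : lieAlgebraType K).
Implicit Types x y z : g.

Lemma lieDl x y z : lie (x + y) z = lie x z + lie y z.
Proof. by have := lie_linearl z 1 x y; rewrite !scale1r. Qed.

Lemma lieDr x y z : lie x (y + z) = lie x y + lie x z.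
Proof. by have := lie_linearr x 1 y z; rewrite !scale1r. Qed.

Lemma lie0r x : lie x 0 = 0 :> g.
Proof. by apply: (addrI (lie x 0)); rewrite -lieDr !addr0. Qed.

Lemma lieZr (k : K) x y : lie x (k *: y) = k *: lie x y.
Proof. by have := lie_linearr x k y 0; rewrite !addr0 lie0r addr0. Qed.

Lemma lieC x y : lie x y = - lie y x.
Proof.
have := liexx (x + y); rewrite lieDl !lieDr !liexx addr0 add0r => /eqP.
by rewrite addr_eq0 => /eqP.
Qed.

Lemma lieNr x y : lie x (- y) = - lie x y.
Proof. by rewrite -scaleN1r lieZr scaleN1r. Qed.

(** The Jacobi identity, in the form: [lie x] is a derivation. *)
Lemma lie_lie x y z : lie x (lie y z) = lie (lie x y) z + lie y (lie x z).
Proof.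
have /eqP := lie_jacobi x y z; rewrite -addrA addr_eq0 => /eqP ->.
by rewrite (lieC z x) lieNr opprD opprK addrC (lieC (lie x y)).
Qed.

Lemma ad_lie x y : ad (lie x y) = (ad x \o ad y)%VF - (ad y \o ad x)%VF.
Proof.
apply/lfunP => z; rewrite add_lfunE opp_lfunE !comp_lfunE !adE.
by rewrite (lie_lie x) addrK.
Qed.

Lemma ad_linear : linear (@ad K g).
Proof.
move=> k x y; apply/lfunP => z; rewrite add_lfunE scale_lfunE !adE.
by rewrite lieDl lieZl.
Qed.

HB.instance Definition _ := GRing.isLinear.Build K g 'End(g) *:%R (@ad K g)
  ad_linear.

End LieCalculus.

(** * Eigenvectors and traces *)

Section Eigenvalues.
Variables (K : fieldType) (V : vectType K).

Lemma eigenvector_rVof (f : 'End(V)) c (v : V) : f v = c *: v ->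
  (rVof (vbasis {:V}) v
     <= eigenspace (mxof (vbasis {:V}) (vbasis {:V}) f) c)%MS.
Proof.
move=> fv; apply/eigenspaceP.
by rewrite -rVof_app ?vbasisP // fv linearZ.
Qed.

(** An endomorphism has finitely many eigenvalues. This is what makes raising
    and lowering operators locally nilpotent. *)
Lemma eigenvectors_vanish (f : 'End(V)) (mu : nat -> K) (v : nat -> V) :
  injective mu -> (forall k, f (v k) = mu k *: v k) -> exists k, v k = 0.
Proof.
move=> mu_inj fv; apply: contrapT => nv0.
pose A := mxof (vbasis {:V}) (vbasis {:V}) f.
have rootA k : root (char_poly A) (mu k).
  rewrite -eigenvalue_root_char; apply/eigenvalueP.
  exists (rVof (vbasis {:V}) (v k)).
    exact/eigenspaceP/eigenvector_rVof.
  rewrite rVof_eq0 ?vbasisP //.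
  by apply/eqP => vk0; apply: nv0; exists k.
have : (size (mkseq mu (\dim {:V}).+1) < size (char_poly A))%N.
  apply: max_poly_roots; rewrite ?monic_neq0 ?char_poly_monic ?mkseq_uniq //.
  by apply/allP => _ /mapP[k _ ->].
by rewrite size_mkseq size_char_poly ltnn.
Qed.

End Eigenvalues.

(** The [c]-eigenspace of [ad k] is stable under [ad x] for every [x] that
    commutes with [k]; as [k] is a sum of brackets of such elements, the
    restriction of [ad k] to it is a sum of commutators and has trace 0. It is
    also the scalar [c], of trace [c] times a nonzero dimension. *)
Lemma lie_prod_eigenvalue0 (K : numFieldType) (g : lieAlgebraType K)
    (A B : {vspace g}) (k v : g) (c : K) :
  (forall x, x \in A -> lie k x = 0) -> (forall y, y \in B -> lie k y = 0) ->
  k \in lie_prod A B -> lie k v = c *: v -> v != 0 -> c = 0.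
Proof.
move=> kA kB kAB kv v0.
pose mxad x := mxof (vbasis {:g}) (vbasis {:g}) (ad x).
have mxad_lie x y : mxad (lie x y) = mxad y *m mxad x - mxad x *m mxad y.
  by rewrite /mxad ad_lie linearB /= !(mxof_comp _ _ (vbasisP _)).
pose M := row_base (eigenspace (mxad k) c).
have stab x : lie k x = 0 -> stablemx M (mxad x).
  move=> kx; rewrite stablemx_row_base; apply: comm_mx_stable_eigenspace.
  apply/esym/eqP; rewrite -subr_eq0 -mxad_lie kx.
  by rewrite /mxad !linear0.
(* the trace of the restriction of [ad x] to the eigenspace *)
pose tau x : K^o := \tr (conjmx M (mxad x)).
have tau_linear : linear tau.
  move=> r x y; rewrite /tau /mxad /conjmx [ad (_ + _)]linearP.
  by rewrite [mxof _ _ (_ + _)]linearP mulmxDr mulmxDl -scalemxAr -scalemxAl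
    [\tr (_ + _)]linearP.
pose tauL := HB.pack_for {linear g -> K^o} tau
  (GRing.isLinear.Build K g K^o *:%R tau tau_linear).
have tau0 : (lie_prod A B <= lker (linfun tauL))%VS.
  apply/lie_prodP => x y xA yB; rewrite memv_ker lfunE /= /tau mxad_lie.
  rewrite /conjmx mulmxBr mulmxBl -!/(conjmx M _) !conjmxM ?inE ?stab //;
    try solve [exact: kA | exact: kB].
  by rewrite linearB /= mxtrace_mulC subrr.
have := subvP tau0 k kAB; rewrite memv_ker lfunE /= /tau.
rewrite (conjmx_eigenvalue (a := c)) ?eq_row_base ?row_base_free //.
rewrite mxtrace_scalar mulrn_eq0 => /orP[|/eqP//].
rewrite mxrank_eq0 => /eqP E0.
have := eigenvector_rVof (f := ad k) (c := c) (v := v).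
rewrite adE kv => /(_ erefl); rewrite -/(mxad k) E0 submx0.
by rewrite rVof_eq0 ?vbasisP // (negbTE v0).
Qed.

(** * Representations of sl2 *)

Section Sl2.
Variables (K : numFieldType) (g : lieAlgebraType K) (x y h : g).
Hypotheses (hx : lie h x = 2 *: x) (hy : lie h y = - 2 *: y) (xy : lie x y = h).
Implicit Types (u v : g) (l : K).

Lemma sl2_raise u l k : lie h u = l *: u ->
  lie h (iter k (lie x) u) = (l + 2 * k%:R) *: iter k (lie x) u.
Proof.
move=> hu; elim: k => [|k IHk] /=; first by rewrite mulr0 addr0.
rewrite lie_lie hx IHk lieZl lieZr -scalerDl; congr (_ *: _).
by rewrite -natr1; ring.
Qed.

Lemma sl2_lower v l k : lie h v = l *: v ->
  lie h (iter k (lie y) v) = (l - 2 * k%:R) *: iter k (lie y) v.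
Proof.
move=> hv; elim: k => [|k IHk] /=; first by rewrite mulr0 subr0.
rewrite lie_lie hy IHk lieZl lieZr -scalerDl; congr (_ *: _).
by rewrite -natr1; ring.
Qed.

Lemma sl2_raise_lower v l k : lie h v = l *: v -> lie x v = 0 ->
  lie x (iter k.+1 (lie y) v) =
    (k.+1%:R * (l - k%:R)) *: iter k (lie y) v.
Proof.
move=> hv xv; elim: k => [|k IHk].
  by rewrite /= lie_lie xy hv xv lie0r addr0; congr (_ *: _); ring.
rewrite iterS lie_lie xy IHk lieZr (sl2_lower _ hv) -iterS -scalerDl.
by congr (_ *: _); rewrite -!natr1; ring.
Qed.

(** Raise [u] to a highest weight vector [v], then lower [v] to 0. If [n] is the
    last exponent with [iter n (lie y) v != 0], then [sl2_raise_lower] at [n]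
    forces the weight [l + 2 k] of [v] to be [n]. *)
Lemma sl2_string u l : lie h u = l *: u -> u != 0 ->
  exists n k : nat, l = n%:R - (2 * k)%:R /\
    forall j, (j <= n)%N -> iter j (lie y) (iter k (lie x) u) != 0.
Proof.
move=> hu u0.
have vanish k0 w : (exists k, iter k (lie k0) w = 0) -> w != 0 ->
    exists2 k, iter k (lie k0) w != 0 & iter k.+1 (lie k0) w = 0.
  case=> k + w0; elim: k => [|k IHk] wk.
    by move: wk w0 => /= ->; rewrite eqxx.
  by have [/IHk//|wk0] := eqVneq (iter k (lie k0) w) 0; exists k.
have two0 : (2 : K) != 0 by rewrite pnatr_eq0.
have [k v0 xv] : exists2 k, iter k (lie x) u != 0 & iter k.+1 (lie x) u = 0.
  apply: vanish => //.
  apply: (@eigenvectors_vanish _ _ (ad h) (fun k => l + 2 * k%:R)).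
    by move=> i j /addrI/(mulfI two0)/eqP; rewrite eqr_nat => /eqP.
  by move=> k; rewrite adE (sl2_raise _ hu).
set v := iter k _ _ in v0 *.
have hv : lie h v = (l + 2 * k%:R) *: v by rewrite (sl2_raise _ hu).
have [n w0 yw] : exists2 n, iter n (lie y) v != 0 & iter n.+1 (lie y) v = 0.
  apply: vanish => //.
  apply: (@eigenvectors_vanish _ _ (ad h)
    (fun j => l + 2 * k%:R - 2 * j%:R)).
    by move=> i j /addrI/oppr_inj/(mulfI two0)/eqP; rewrite eqr_nat => /eqP.
  by move=> j; rewrite adE (sl2_lower _ hv).
exists n, k; split.
  have /eqP := sl2_raise_lower n hv xv.
  rewrite yw lie0r eq_sym scaler_eq0 (negbTE w0) orbF mulf_eq0.
  rewrite pnatr_eq0 /= subr_eq0 => /eqP <-.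
  by rewrite natrM addrK.
move=> j le_jn; apply: contraNneq w0 => wj0.
rewrite -(subnK le_jn) iterD wj0.
by elim: (n - j)%N => //= i /eqP ->; rewrite lie0r.
Qed.

End Sl2.

(** * Reflections preserve the roots *)

Section Reflections.
Variables (K : numFieldType) (g : lieAlgebraType K) (t : {vspace g}).
Implicit Types (a b c : dual t) (h : subvs_of t) (x y u : g).

Let val_vsproj x : x \in t -> \val (vsproj t x) = x.
Proof. exact: vsprojK. Qed.

Lemma root_space_act a h x : x \in root_space a ->
  lie (val h) x = (a h : K) *: x.
Proof. by move=> /root_spaceP. Qed.

Lemma root_space_lie a b x y :
  x \in root_space a -> y \in root_space b -> lie x y \in root_space (a + b).
Proof.
move=> /root_spaceP xa /root_spaceP yb; apply/root_spaceP => h.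
by rewrite lie_lie xa yb lieZl lieZr add_lfunE scalerDl.
Qed.

Lemma root_space_iter a c x u k : x \in root_space a -> u \in root_space c ->
  iter k (lie x) u \in root_space (c + a *+ k).
Proof.
move=> xa uc; elim: k => [|k IHk]; first by rewrite mulr0n addr0.
by rewrite mulrS addrCA; apply: root_space_lie.
Qed.

Lemma root_space_neq0 a x : x \in root_space a -> x != 0 ->
  root_space a <> 0%VS.
Proof. by move=> xa x0 a0; rewrite a0 memv0 (negbTE x0) in xa. Qed.

(** In a string of highest weight [n], the weight [n - 2 k] is met after [k]
    steps down and its opposite after [n - k] steps; when [n - 2 k] is
    nonnegative, [n - k] steps down follow [k] steps up without leaving the
    string. *)
Lemma sl2_weight_reflection_half a c h x y :
  x \in root_space a -> y \in root_space (- a) -> val h = lie x y ->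
  a h = 2 -> root_space c <> 0%VS ->
  exists n k : nat, (c h : K) = n%:R - (2 * k)%:R /\
    ((2 * k <= n)%N -> root_space (c - (c h : K) *: a) <> 0%VS).
Proof.
move=> xa ya hxy ah c0.
have [u uc u0] : exists2 u, u \in root_space c & u != 0.
  by exists (vpick (root_space c)); rewrite ?memv_pick ?vpick0 //; apply/eqP.
have hx : lie (val h) x = 2 *: x by rewrite (root_space_act _ xa) ah.
have hy : lie (val h) y = - 2 *: y.
  by rewrite (root_space_act _ ya) opp_lfunE ah.
have hu : lie (val h) u = (c h : K) *: u by apply: root_space_act.
have [n [k [ch nz]]] := sl2_string hx hy (esym hxy) hu u0.
exists n, k; split=> // le2kn.
have lekn : (k <= n)%N by rewrite (leq_trans _ le2kn) // leq_pmull.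
apply: (@root_space_neq0 _ (iter (n - k) (lie y) (iter k (lie x) u))).
  have := root_space_iter (n - k) ya (root_space_iter k xa uc).
  congr (_ \in root_space _); rewrite -addrA; congr (_ + _).
  have [m nE] : exists m, n = (2 * k + m)%N.
    by exists (n - 2 * k)%N; rewrite subnKC.
  rewrite ch nE natrD addrAC subrr add0r scaler_nat mulNrn.
  rewrite (_ : 2 * k + m - k = k + m)%N; last first.
    by rewrite mul2n -addnn -addnA addKn.
  by rewrite mulrnDr opprD addrA subrr add0r.
by apply: nz; rewrite leq_subr.
Qed.

Lemma sl2_weight_reflection a c h x y :
  x \in root_space a -> y \in root_space (- a) -> val h = lie x y ->
  a h = 2 -> root_space c <> 0%VS -> root_space (c - (c h : K) *: a) <> 0%VS.
Proof.
move=> xa ya hxy ah c0.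
have [n [k [ch]]] := sl2_weight_reflection_half xa ya hxy ah c0.
case: leqP => [le2kn /(_ isT)//|ltn2k _].
(* Exchanging x and y turns h into - h, hence makes the weight positive. *)
have [||||n' [k' [ch' +]]] :=
  @sl2_weight_reflection_half (- a) c (- h) y x _ _ _ _ c0.
- by [].
- by rewrite opprK.
- by rewrite linearN /= hxy -lieC.
- by rewrite opp_lfunE linearN /= ah opprK.
rewrite [c (- h)]linearN /= scalerN scaleNr opprK; apply.
rewrite -(ler_nat K) -subr_ge0 -ch' linearN /= ch opprB subr_ge0 ler_nat.
exact: ltnW.
Qed.

Hypothesis cartan_t : is_cartan t.

(** The centralizer of [t] normalizes [t]. *)
Lemma root_space0_cartan x : x \in root_space (0 : dual t) -> x \in t.
Proof.
case: cartan_t => _ _ norm_t /root_spaceP x0; apply: norm_t => y yt.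
have := x0 (vsproj t y); rewrite val_vsproj // zero_lfunE scale0r => xy0.
by rewrite lieC xy0 oppr0 mem0v.
Qed.

(** A coroot is only a sum of brackets; but if [a] vanished on every single
    bracket, it would vanish on the coroot. *)
Lemma coroot_sl2 a h : is_coroot a h -> exists x y h',
  [/\ x \in root_space a, y \in root_space (- a), val h' = lie x y & a h' = 2].
Proof.
case=> hin ah.
have lie_t x y : x \in root_space a -> y \in root_space (- a) -> lie x y \in t.
  by move=> xa ya; rewrite root_space0_cartan // -(subrr a) root_space_lie.
have [x [y [xa ya axy]]] : exists x y, [/\ x \in root_space a,
    y \in root_space (- a) & a (vsproj t (lie x y)) != 0].
  apply: contrapT => none.
  have : (lie_prod (root_space a) (root_space (- a)) <=
      linfun (@vsval _ _ t) @: lker a)%VS.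
    apply/lie_prodP => x y xa ya; apply/memv_imgP.
    exists (vsproj t (lie x y)); last by rewrite lfunE /= val_vsproj ?lie_t.
    by rewrite memv_ker; apply: contrapT => /negP axy; apply: none; exists x, y.
  move/subvP/(_ _ hin)/memv_imgP => [h1 + /esym/eqP].
  rewrite lfunE /= (inj_eq val_inj) memv_ker => + /eqP h1h.
  by rewrite h1h ah pnatr_eq0.
pose d : K := 2 / a (vsproj t (lie x y)).
exists (d *: x), y, (d *: vsproj t (lie x y)); split => //.
- by rewrite memvZ.
- by rewrite linearZ /= val_vsproj ?lie_t // lieZl.
- by rewrite linearZ; apply: divfK.
Qed.

(** [a] vanishes on the difference of two coroots of [a], which therefore
    commutes with the root spaces of [a] and [- a], while being a sum of their
    brackets. *)
Lemma coroot_weight_eq a h h' c : is_coroot a h -> is_coroot a h' ->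
  root_space c <> 0%VS -> c h = c h'.
Proof.
move=> [hin ah] [h'in ah'] c0.
apply/eqP; rewrite -subr_eq0 -linearB /=; apply/eqP.
have ahh' : a (h - h') = 0 by rewrite linearB /= ah ah' subrr.
apply: (@lie_prod_eigenvalue0 _ _ (root_space a) (root_space (- a))
  (val (h - h')) (vpick (root_space c))).
- by move=> x /root_spaceP ->; rewrite ahh' scale0r.
- by move=> x /root_spaceP ->; rewrite opp_lfunE ahh' oppr0 scale0r.
- by rewrite linearB /= memvB.
- exact: root_space_act (memv_pick _).
- by rewrite vpick0; apply/eqP.
Qed.

Lemma reflection_roots a s c : is_reflection a s -> roots c -> roots (s c).
Proof.
move=> [h ha sE] [c0 gc0]; rewrite sE.
have [x [y [h' [xa ya h'xy ah']]]] := coroot_sl2 ha.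
have h'a : is_coroot a h'.
  split=> //; rewrite h'xy.
  have /lie_prodP := subvv (lie_prod (root_space a) (root_space (- a))).
  by apply.
split; last first.
  rewrite (coroot_weight_eq ha h'a gc0).
  exact: sl2_weight_reflection xa ya h'xy ah' gc0.
(* If [c = c(h) a], evaluation at [h] gives [c(h) = 2 c(h)]. *)
move=> /eqP; rewrite subr_eq0 => /eqP cE; apply: c0.
have : c h = c h + c h.
  by rewrite {1}cE scale_lfunE ha.2 -mulr2n; apply: mulr_natr.
rewrite -{1}[c h]addr0 => /addrI ch0.
by rewrite cE -ch0 scale0r.
Qed.

Lemma reflection_involutive a s : is_reflection a s -> involutive s.
Proof.
move=> [h [_ ah] sE] c; rewrite !sE add_lfunE opp_lfunE scale_lfunE ah.
rewrite -addrA -opprD -scalerDl [X in X *: a](_ : _ = 0) ?scale0r ?subr0 //.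
by rewrite -[_ *: _]/(_ * _); ring.
Qed.

Lemma weyl_roots w : weyl w ->
  (forall c, roots c -> roots (w c)) /\
  exists w' : dual t -> dual t,
    [/\ forall c, roots c -> roots (w' c), cancel w' w & cancel w w'].
Proof.
elim=> {w} [|a s w _ refl_s _ [wr [w' [w'r w'K wK]]]].
  by split=> [c|]; last exists id; do ?split=> c; rewrite ?id_lfunE.
have sK := reflection_involutive refl_s.
split=> [c rc|].
  by rewrite comp_lfunE; apply/(reflection_roots refl_s)/wr.
exists (w' \o s); split=> c /=; last by rewrite comp_lfunE sK wK.
  by move=> rc; apply/w'r/(reflection_roots refl_s).
by rewrite comp_lfunE w'K sK.
Qed.

End Reflections.

(** * Positive roots and levels *)

Section PositiveRoots.
Variables (K : numFieldType) (g : lieAlgebraType K) (t : {vspace g}).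
Variable P : set (dual t).
Hypothesis posP : positive_system P.
Implicit Types (a b c : dual t) (z h : subvs_of t) (w : 'End(dual t)).

Lemma setNP (Q : set (dual t)) a : [set - b | b in Q] a <-> Q (- a).
Proof.
split=> [[b Qb <-]|Qa]; first by rewrite opprK.
by exists (- a); rewrite ?opprK.
Qed.

Lemma rootsP a : roots a <-> P a \/ P (- a).
Proof.
case: posP => -> _; split=> -[Pa|Pa]; [by left| |by left|].
  by right; apply/setNP.
by right; apply/setNP.
Qed.

Lemma rootsN a : roots a -> roots (- a).
Proof. by rewrite !rootsP opprK => -[]; [right|left]. Qed.

Lemma positiveN a : P a -> ~ P (- a).
Proof.
case: posP => _ [h _ hpos] /hpos ah /hpos.
by rewrite opp_lfunE oppr_gt0 => /(lt_trans ah); rewrite ltxx.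
Qed.

(** The difference is a sum of simple roots, on which [h] is positive. *)
Lemma highest_root_ge theta h c : highest_root P theta ->
  (forall a, P a -> 0 < a h) -> roots c -> (c h : K) <= theta h.
Proof.
move=> [_ maxt] hpos /maxt[r [simple_r]] /(congr1 (fun f : dual t => f h)).
rewrite add_lfunE opp_lfunE sum_lfunE => bE.
rewrite -subr_ge0 [X in 0 <= X]bE big_seq sumr_ge0 // => i.
by move=> /simple_r[/hpos/ltW].
Qed.

Lemma highest_root_positive theta : highest_root P theta -> P theta.
Proof.
move=> maxt; have [//|Pn] := (rootsP theta).1 maxt.1.
case: posP => _ [h _ hpos]; have := hpos _ Pn.
have rn : roots (- theta) by apply/rootsP; left.
have := highest_root_ge maxt hpos rn; rewrite opp_lfunE => le_t t0.
have := lt_le_trans t0 le_t; rewrite oppr_gt0 in t0 => /(lt_trans t0).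
by rewrite ltxx.
Qed.

Lemma highest_root_max theta b : highest_root P theta -> P b ->
  ~ roots (theta + b).
Proof.
case: posP => _ [h _ hpos] maxt /hpos bh /(highest_root_ge maxt hpos).
by rewrite add_lfunE gerDl => /(lt_le_trans bh); rewrite ltxx.
Qed.

(** The roots that [w] makes positive are the positive roots that are not
    inversions, of level -1 or 0, and the opposites of the inversions, of level
    -1 or -2. *)
Lemma wz_preimage_level z w b :
  (forall a, P a -> a z \in [:: -1; 0; 1; 2]) -> is_wz P z w ->
  roots b -> P (w b) -> exists m : nat, b z = - m%:R /\ (m = 0%N -> P b).
Proof.
move=> zP [_ invw] rb Pwb.
have invP a : inversions P w a <-> P a /\ (a z = 1 \/ a z = 2).
  rewrite invw; split=> [[[Pa az]|[Pa az]]|[Pa [az|az]]].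
  - by split=> //; left.
  - by split=> //; right.
  - by left.
  - by right.
have [Pb|Pnb] := (rootsP b).1 rb.
  have ninv : ~ inversions P w b by move=> [_ /setNP]; apply: positiveN.
  have := zP b Pb; rewrite !inE => /or4P[] /eqP bz.
  - by exists 1%N.
  - by exists 0%N; rewrite oppr0.
  - by case: ninv; apply/invP; split=> //; left.
  - by case: ninv; apply/invP; split=> //; right.
have /invP[_] : inversions P w (- b).
  by split=> //; apply/setNP; rewrite linearN opprK.
rewrite opp_lfunE => -[] /eqP; rewrite eqr_oppLR => /eqP ->.
  by exists 1%N.
by exists 2%N.
Qed.

End PositiveRoots.

(** * The images of the indecomposable roots of level 0 and of [theta] *)

Theorem proposition6p1 (R : realType) (g : lieAlgebraType R[i])
    (t : {vspace g}) (P : set (dual t)) (theta : dual t)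
    (z : subvs_of t) (w : 'End(dual t)) :
  simple_lie g -> is_cartan t -> positive_system P -> highest_root P theta ->
  rational_form z ->
  (forall a : dual t, P a -> a z \in [:: -1; 0; 1; 2]) ->
  is_wz P z w ->
  (forall a : dual t, level P z 0 a ->
     ~ (exists b c : dual t,
          [/\ level P z 0 b, level P z 0 c & a = b + c]) ->
     simple_roots P (w a)) /\
  (theta z = 1 -> [set - b | b in simple_roots P] (w theta)).
Proof.
move=> _ cartan_t posP maxt _ zP wzP.
have [w_roots [w' [w'_roots w'K wK]]] := weyl_roots cartan_t wzP.1.
have w'D a b c : w a = b + c -> a = w' b + w' c.
  by move=> wa; apply: (can_inj wK); rewrite linearD /= !w'K.
have pull b : P b -> exists m : nat, w' b z = - m%:R /\ (m = 0%N -> P (w' b)).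
  move=> Pb; apply: (wz_preimage_level posP zP wzP); rewrite ?w'K //.
  by apply/w'_roots/(rootsP posP); left.
have invP a : P a -> P (- w a) <-> a z = 1 \/ a z = 2.
  move=> Pa; transitivity (inversions P w a).
    by split=> [Pwa|[_ /setNP]//]; split=> //; apply/setNP.
  rewrite wzP.2; split=> [[[_ az]|[_ az]]|[az|az]]; by [left|right].
split=> [a [Pa az] a_indec|thetaz].
  have {}az : a z = 0 := az.
  split.
    have ra : roots a by apply/(rootsP posP); left.
    have [//|/(invP a Pa)] := (rootsP posP (w a)).1 (w_roots a ra).
    by rewrite az => -[] /eqP; rewrite eq_sym ?oner_eq0 ?pnatr_eq0.
  move=> [b [c [Pb Pc /w'D aE]]].
  have [m [bm bP]] := pull b Pb; have [n [cn cP]] := pull c Pc.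
  have : - m%:R - n%:R = 0 :> R[i].
    by have := congr1 (fun f : dual t => f z) aE; rewrite add_lfunE bm cn az.
  rewrite -opprD -natrD => /eqP; rewrite oppr_eq0 pnatr_eq0.
  rewrite addn_eq0 => /andP[/eqP m0 /eqP n0]; apply: a_indec.
  exists (w' b), (w' c); split=> //; split; rewrite ?bm ?cn ?m0 ?n0 ?oppr0; auto.
have Ptheta := highest_root_positive posP maxt.
apply/setNP; split; first by apply/(invP _ Ptheta); left.
(* Otherwise [w' b] is positive and [theta + w' b = - w' c] is a root. *)
have no_split b c : P b -> P c -> - theta = w' b + w' c -> w' b z <> 0.
  move=> Pb Pc thE b0; have [m [bm bP]] := pull b Pb.
  have Pw'b : P (w' b).
    by apply: bP; apply/eqP; rewrite -(eqr_nat R[i]) -oppr_eq0 -bm b0.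
  apply: (highest_root_max posP maxt Pw'b).
  rewrite -[theta]opprK thE opprD addrAC addNr add0r.
  by apply/(rootsN posP)/w'_roots/(rootsP posP); left.
move=> [b [c [Pb Pc]]]; rewrite -linearN => /w'D thE.
have [m [bm _]] := pull b Pb; have [n [cn _]] := pull c Pc.
have : - m%:R - n%:R = - 1 :> R[i].
  have := congr1 (fun f : dual t => f z) thE.
  by rewrite add_lfunE opp_lfunE bm cn thetaz.
rewrite -opprD -natrD => /eqP; rewrite eqr_opp -[1]/(1%:R) eqr_nat.
case: m bm => [|m] bm.
  by move=> _; apply: no_split Pb Pc thE _; rewrite bm oppr0.
rewrite addSn eqSS addn_eq0 => /andP[_ /eqP n0].
by rewrite addrC in thE; apply: no_split Pc Pb thE _; rewrite cn n0 oppr0.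
Qed.
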